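(* Let $n$ be a positive integer and let $\mathscr{H}=(\mathscr{V},\mathscr{E})$ be a linear $n$-uniform hypergraph with exactly $n$ edges. If $\mathscr{H}$ is weakly dense, i.e. for every integer $k$ with $2\le k<\sqrt{n}$ there are at most $k^2$ vertices of $\mathscr{H}$ of degree $k$, then $\chi(\mathscr{H})=n$.
   Context: A hypergraph $\mathscr{H}$ is a pair $(\mathscr{V},\mathscr{E})$, where $\mathscr{E}$ is a finite family of nonempty sets (the edges) and $\mathscr{V}=\bigcup_{E\in\mathscr{E}}E$ (the vertices). $\mathscr{H}$ is linear if any two distinct edges share at most one vertex, and $n$-uniform if each edge has exactly $n$ vertices. The degree $d(v)$ of a vertex $v$ is the number of edges containing $v$. A hypergraph with $n$ edges is weakly dense if no integer $k$ in the half-open interval $[2,\sqrt{n})$ is the degree of more than $k^2$ vertices. A $k$-coloring of $\mathscr{H}$ is a function $f:\mathscr{V}\to\{0,\ldots,k-1\}$ such that $f(v)\ne f(v')$ whenever $v\neq v'$ are vertices belonging to a common edge. The chromatic number $\chi(\mathscr{H})$ is the smallest $k$ for which a $k$-coloring of $\mathscr{H}$ exists. *)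

(* Defs.v *)
From mathcomp Require Import all_boot.

Set Implicit Arguments.
Unset Strict Implicit.
Unset Printing Implicit Defensive.

(* The finite type [T] is only an ambient universe: vertices are the elements *)
(* of the union of the edges, not all elements of [T].                        *)
Record hypergraph (T : finType) := Hypergraph {
  edges : {set {set T}};
  edges_nonempty : set0 \notin edges
}.

Section Hypergraph.

Variables (T : finType) (H : hypergraph T).

Definition vertices : {set T} := cover (edges H).

Definition linear_hypergraph : Prop :=
  forall A B : {set T}, A \in edges H -> B \in edges H -> A != B ->
    #|A :&: B| <= 1.

Definition uniform_hypergraph (n : nat) : Prop :=
  forall A : {set T}, A \in edges H -> #|A| = n.

Definition degree (v : T) : nat := #|[set A in edges H | v \in A]|.

(* [k ^ 2 < #|edges H|] is k < sqrt n, where n is the number of edges. *)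
Definition weakly_dense : Prop :=
  forall k : nat, 2 <= k -> k ^ 2 < #|edges H| ->
    #|[set v in vertices | degree v == k]| <= k ^ 2.

(* Two vertices of a common edge get distinct colors (strong coloring). *)
Definition coloring (k : nat) (f : {v : T | v \in vertices} -> 'I_k) : bool :=
  [forall u, forall v,
     (u != v) && [exists A in edges H, (val u \in A) && (val v \in A)]
     ==> (f u != f v)].

Definition colorable (k : nat) : bool :=
  [exists f : {ffun {v : T | v \in vertices} -> 'I_k}, coloring f].

Lemma colorable_exists : exists k, colorable k.
Proof.
exists #|{: {v : T | v \in vertices}}|; apply/existsP.
exists [ffun v => enum_rank v]; apply/forallP => u; apply/forallP => v.
by apply/implyP => /andP[neq_uv _]; rewrite !ffunE (inj_eq enum_rank_inj).
Qed.

Definition chromatic_number : nat := ex_minn colorable_exists.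

End Hypergraph.

(* Main.v *)
(** Colour the vertices greedily by decreasing degree. Let [v] have degree [k > 1].
    Each edge missing [v] contains at most [k] neighbours of [v], so the sum of
    [degree w - 1] over the neighbours [w] of [v] is at most [k * (n - k)]. If
    [v] had [n] neighbours of degree at least [k], this sum would be at least
    [n * (k - 1)], which is too large when [n < k ^ 2]; when [k ^ 2 < n], at most
    [k ^ 2 - 1] of them have degree [k] by weak density, so that the sum would
    be at least [n * k - (k ^ 2 - 1)], which is too large as well.

    When [n = k ^ 2] greed may fail at [v], but only if all the inequalities
    are equalities: [v] has exactly [n] neighbours of degree at least [k], two of
    them are not adjacent, and the other vertices of degree at least [k] form
    together with [v] an independent set. These vertices can then be coloured by
    hand with [n] colours, before the greedy procedure is run on the rest. *)

Require Import Defs.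
From mathcomp Require Import all_boot.
From mathcomp Require Import zify.

Set Implicit Arguments.
Unset Strict Implicit.
Unset Printing Implicit Defensive.

(** * Greedy extension of a partial colouring *)

Definition proper_on (T : finType) (C : eqType) (e : rel T) (S : {set T})
    (f : T -> C) : Prop :=
  {in S &, forall u v, e u v -> f u != f v}.

(** At an uncoloured vertex with [d] maximal, the coloured neighbours all have [d] at least as
    large, so they block fewer than [n] colours. An arbitrary [S] leaves room for a start by
    hand. *)
Lemma greedy_coloring (T : finType) (e : rel T) (d : T -> nat) (n : nat)
    (S : {set T}) (f : T -> 'I_n) :
  symmetric e -> irreflexive e -> proper_on e S f ->
  (forall u v, u \in S -> v \notin S -> d v <= d u) ->
  (forall v, v \notin S -> #|[set w | e v w & d v <= d w]| < n) ->
  exists g : T -> 'I_n, proper_on e setT g.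
Proof.
move=> e_sym e_irr.
have [m] := ubnP #|~: S|; elim: m => // m IHm in S f *; rewrite ltnS.
move=> leSm f_proper S_up few.
have [S0 | [v0]] := set_0Vmem (~: S).
  by exists f; rewrite -setC0 -S0 setCK.
rewrite inE => v0S.
case: (@arg_maxnP _ v0 [pred v | v \notin S] d v0S) => v /= vS v_max.
pose N := [set w | e v w & d v <= d w].
(* [N] may contain vertices outside [S], where [f] is arbitrary; avoiding these values too costs
   nothing. *)
have /card_gt0P[c cN] : 0 < #|~: (f @: N)|.
  rewrite cardsCs setCK card_ord subn_gt0.
  exact: leq_ltn_trans (leq_imset_card _ _) (few _ vS).
have fc w : w \in S -> e v w -> f w != c.
  move=> wS evw; apply: contraTneq cN => <-; rewrite inE negbK.
  by apply: imset_f; rewrite inE evw S_up.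
apply: (IHm (v |: S) (fun w => if w == v then c else f w)).
- apply: leq_trans leSm; apply: proper_card; rewrite properC properE subsetUr.
  by apply/subsetPn; exists v => //; rewrite setU11.
- move=> x y; rewrite !inE.
  have [-> _|_ /= xS] := eqVneq x v; have [->|_ /= yS] := eqVneq y v.
  + by rewrite e_irr.
  + by rewrite eq_sym; apply: fc.
  + by rewrite e_sym => _; apply: fc.
  + exact: f_proper.
- move=> x y; rewrite !inE negb_or => xS /andP[_ yS].
  by case/predU1P: xS => [->|xS]; [apply: v_max | apply: S_up].
- by move=> x; rewrite inE negb_or => /andP[_]; apply: few.
Qed.

(** * Adjacency and double counting of degrees *)

Section Adjacency.

Variables (T : finType) (H : hypergraph T).
Hypothesis H_linear : linear_hypergraph H.

Implicit Types (u v w : T) (A B : {set T}).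

Definition adj u v :=
  (u != v) && [exists A in edges H, (u \in A) && (v \in A)].

(** Ties are included: these are all the neighbours that may precede [v] in the greedy order. *)
Definition upper_nbrs v := [set w | adj v w & degree H v <= degree H w].

Lemma adjP u v :
  reflect (u <> v /\ exists A, [/\ A \in edges H, u \in A & v \in A]) (adj u v).
Proof.
apply: (iffP andP) => [[/eqP uv /exists_inP[A AH /andP[uA vA]]] | [/eqP uv]].
  by split=> //; exists A.
by case=> A [AH uA vA]; split=> //; apply/exists_inP; exists A; rewrite ?uA.
Qed.

Lemma adj_sym : symmetric adj.
Proof.
move=> u v; rewrite /adj eq_sym; congr (_ && _).
by apply: eq_existsb => A; rewrite [(u \in A) && _]andbC.
Qed.

Lemma adj_irr : irreflexive adj.
Proof. by move=> u; rewrite /adj eqxx. Qed.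

Lemma edge_inj A B u v :
  A \in edges H -> B \in edges H -> u != v ->
  u \in A -> v \in A -> u \in B -> v \in B -> A = B.
Proof.
move=> AH BH uv uA vA uB vB; apply: contraNeq uv => AB; apply/eqP.
by apply: (card_le1_eqP (H_linear AH BH AB)); rewrite inE ?uA ?vA.
Qed.

Lemma card_edges_missing v :
  #|[set B in edges H | v \notin B]| = #|edges H| - degree H v.
Proof.
have -> : [set B in edges H | v \notin B]
          = edges H :\: [set A in edges H | v \in A].
  by apply/setP=> B; rewrite !inE; case: (B \in edges H); rewrite ?andbF ?andbT.
rewrite cardsD (setIidPr _) //.
by apply/subsetP => A; rewrite inE => /andP[].
Qed.

(** By linearity exactly one edge joins [v] to [w]; the successor counts it. *)
Lemma degree_adj v w : adj v w ->
  degree H w = #|[set B in edges H | (v \notin B) && (w \in B)]|.+1.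
Proof.
case/adjP=> /eqP vw [A [AH vA wA]]; rewrite /degree (cardsD1 A) inE AH wA add1n.
congr _.+1; apply: eq_card => B; rewrite !inE.
have [->|BA] /= := eqVneq B A; first by rewrite vA andbF.
case: (boolP (B \in edges H)) => //= BH.
case: (boolP (w \in B)) => wB; rewrite ?andbF ?andbT //.
apply/esym; apply: contra BA => vB; apply/eqP.
exact: (@edge_inj B A v w).
Qed.

(** Sending a neighbour in [B] to an edge joining it to [v] is injective: two neighbours with the
    same image would force that edge to be [B], which misses [v]. *)
Lemma card_adj_edge v B : B \in edges H -> v \notin B ->
  #|[set w in B | adj v w]| <= degree H v.
Proof.
move=> BH vB.
pose h w := odflt set0 [pick A in edges H | (v \in A) && (w \in A)].
have hP w : adj v w -> [/\ h w \in edges H, v \in h w & w \in h w].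
  case/adjP=> _ [A [AH vA wA]]; rewrite /h; case: pickP => [A'|/(_ A)] /=.
    by case/and3P.
  by rewrite AH vA wA.
rewrite -(@card_in_imset _ _ h).
  apply/subset_leq_card/subsetP => _ /imsetP[w + ->].
  by rewrite !inE => /andP[_ /hP[-> ->]].
move=> w w'; rewrite !inE => /andP[wB /hP[hH vh wh]] /andP[w'B /hP[_ _ w'h]] hE.
apply: contraNeq vB => ww'; rewrite -hE in w'h.
by rewrite -(@edge_inj (h w) B w w').
Qed.

Lemma sum_degree_nbrs v (N : {set T}) : {in N, forall w, adj v w} ->
  \sum_(w in N) (degree H w).-1
  = \sum_(B in edges H | v \notin B) #|B :&: N|.
Proof.
move=> Nadj.
transitivity (\sum_(w in N) \sum_(B in edges H | v \notin B) (w \in B : nat)).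
  apply: eq_bigr => w /Nadj/degree_adj->; rewrite -sum1dep_card big_mkcondr /=.
  rewrite [RHS]big_mkcondr; apply: eq_bigr => B _.
  by case: (v \notin B); case: (w \in B).
rewrite exchange_big; apply: eq_bigr => B _.
rewrite -sum1_card [LHS]big_mkcond [RHS]big_mkcond; apply: eq_bigr => w _.
by rewrite inE; case: (w \in B); case: (w \in N).
Qed.

Lemma sum_degree_nbrs_le v (N : {set T}) : {in N, forall w, adj v w} ->
  \sum_(w in N) (degree H w).-1 <= degree H v * (#|edges H| - degree H v).
Proof.
move=> Nadj; rewrite (sum_degree_nbrs Nadj) -card_edges_missing mulnC.
rewrite -sum_nat_const; rewrite [leqRHS](eq_bigl _ _ (fun B => in_set _ B)).
apply: leq_sum => B /andP[BH vB]; apply: leq_trans (card_adj_edge BH vB).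
apply/subset_leq_card/subsetP => w; rewrite !inE => /andP[-> wN]; exact: Nadj.
Qed.

(** Double counting: by linearity each other edge meets [B] in at most one vertex. *)
Lemma sum_degree_edge B : B \in edges H ->
  \sum_(w in B) (degree H w).-1 <= #|edges H|.-1.
Proof.
move=> BH; rewrite (cardsD1 B (edges H)) BH add1n /=.
rewrite -sum1_card.
apply: (@leq_trans (\sum_(A in edges H :\ B) #|A :&: B|)); last first.
  apply: leq_sum => A; rewrite !inE => /andP[AB AH]; exact: H_linear.
have -> : \sum_(A in edges H :\ B) #|A :&: B|
          = \sum_(w in B) \sum_(A in edges H :\ B) (w \in A : nat).
  rewrite exchange_big; apply: eq_bigr => A _.
  rewrite -sum1_card [LHS]big_mkcond [RHS]big_mkcond; apply: eq_bigr => w _.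
  by rewrite inE; case: (w \in B); case: (w \in A).
apply: leq_sum => w wB.
rewrite /degree (cardsD1 B) inE BH wB add1n /= -sum1_card.
rewrite [leqLHS]big_mkcond [leqRHS]big_mkcond; apply: leq_sum => A _.
by rewrite !inE; case: (A != B); case: (A \in edges H); case: (w \in A).
Qed.

Lemma card_nbrs_le v (N : {set T}) : {in N, forall w, adj v w} ->
  #|N| <= \sum_(A in edges H | v \in A) #|A :&: N|.
Proof.
move=> Nadj; apply: (@leq_trans #|\bigcup_(A in edges H | v \in A) (A :&: N)|).
  apply/subset_leq_card/subsetP => w wN.
  have /adjP[_ [A [AH vA wA]]] := Nadj w wN.
  by apply/bigcupP; exists A; rewrite ?AH // inE wA.
elim/big_rec2: _ => [|A k S _ IH]; first by rewrite cards0.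
apply: leq_trans (leq_addr _ _ : _ <= _ + #|(A :&: N) :&: S|) _.
by rewrite cardsUI leq_add2l.
Qed.

Lemma sum_edges_at_const v c : \sum_(A in edges H | v \in A) c = degree H v * c.
Proof.
by rewrite -sum_nat_const; apply: eq_bigl => A; rewrite inE.
Qed.

Lemma upper_nbrs_adj v : {in upper_nbrs v, forall w, adj v w}.
Proof. by move=> w; rewrite inE => /andP[]. Qed.

Lemma upper_nbrs_degree v : {in upper_nbrs v, forall w, degree H v <= degree H w}.
Proof. by move=> w; rewrite inE => /andP[]. Qed.

(** * The greedy step when n is not the square of the degree *)

Section Uniform.

Variable n : nat.
Hypotheses (n_gt0 : 0 < n) (H_uniform : uniform_hypergraph H n).
Hypotheses (H_edges : #|edges H| = n).

Lemma card_nbrs_uniform v (N : {set T}) : {in N, forall w, adj v w} ->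
  #|N| <= degree H v * n.-1.
Proof.
move=> Nadj; apply: leq_trans (card_nbrs_le Nadj) _.
rewrite -sum_edges_at_const; apply: leq_sum => A /andP[AH vA].
rewrite -(H_uniform AH) (cardsD1 v A) vA add1n /=.
apply/subset_leq_card/subsetP => w; rewrite !inE => /andP[-> /Nadj].
by rewrite /adj eq_sym => /andP[->].
Qed.

Lemma degree_le v : degree H v <= n.
Proof.
by rewrite -H_edges; apply/subset_leq_card/subsetP => A; rewrite inE => /andP[].
Qed.

Lemma few_upper_nbrs v : weakly_dense H ->
  (1 < degree H v -> degree H v ^ 2 != n) -> #|upper_nbrs v| < n.
Proof.
move=> H_dense kn; pose k := degree H v.
(* Weak density is silent on degrees 0 and 1, but a single edge gives at most n - 1 neighbours. *)
have [k1|k2] := leqP k 1.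
  have := card_nbrs_uniform (@upper_nbrs_adj v); rewrite -/k; nia.
have {kn} kn : k ^ 2 <> n by apply/eqP/kn.
have kln : k <= n := degree_le v.
have sum_le := sum_degree_nbrs_le (@upper_nbrs_adj v).
rewrite H_edges -/k in sum_le.
rewrite ltnNge; apply/negP => nN.
have [nk|kn2] := leqP n (k ^ 2).
  have : #|upper_nbrs v| * k.-1 <= \sum_(w in upper_nbrs v) (degree H w).-1.
    rewrite -sum_nat_const; apply: leq_sum => w /upper_nbrs_degree.
    rewrite -/k; lia.
  by move/leq_trans/(_ sum_le); nia.
pose N1 := [set w in upper_nbrs v | degree H w == k].
(* Strict because [v] has degree [k] too and is not its own neighbour. *)
have cN1 : #|N1| < k ^ 2.
  apply: leq_trans (H_dense k k2 _); last by rewrite H_edges.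
  apply: (@leq_trans #|v |: N1|).
    by rewrite cardsU1 !inE adj_irr.
  apply/subset_leq_card/subsetP => w /setU1P wP.
  have wk : degree H w == k.
    by case: wP => [->|]; rewrite ?eqxx // inE => /andP[].
  rewrite inE wk andbT.
  have /card_gt0P[A] : 0 < degree H w by rewrite (eqP wk) ltnW.
  by rewrite inE => /andP[AH wA]; apply/bigcupP; exists A.
(* One more for each neighbour of degree exactly [k] makes every term at least [k], yet the total
   stays at most k(n - k) + k^2 - 1 < nk. *)
have : #|upper_nbrs v| * k <=
    \sum_(w in upper_nbrs v) ((degree H w).-1 + (w \in N1)).
  rewrite -sum_nat_const; apply: leq_sum => w wN.
  rewrite inE wN /=; have := upper_nbrs_degree wN; rewrite -/k.
  by case: eqP => /= [->|]; lia.
rewrite big_split /= -[X in _ + X](_ : #|N1| = _); first nia.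
rewrite -sum1_card [LHS]big_mkcond [RHS]big_mkcond; apply: eq_bigr => w _.
by rewrite inE; case: (w \in upper_nbrs v) => //; case: eqP.
Qed.

(** * The extremal case n = k^2 *)

Section Tight.

Variable v : T.
Local Notation k := (degree H v).
Local Notation N := (upper_nbrs v).
Hypotheses (k_gt1 : 1 < k) (k_sq : k ^ 2 = n) (N_large : n <= #|N|).

Lemma tight_sum : \sum_(w in N) (degree H w).-1 <= k * (n - k).
Proof. by rewrite -H_edges; apply/sum_degree_nbrs_le/upper_nbrs_adj. Qed.

Lemma tight_sum_ge : #|N| * k.-1 <= \sum_(w in N) (degree H w).-1.
Proof.
by rewrite -sum_nat_const; apply: leq_sum => w /upper_nbrs_degree; lia.
Qed.

(** For n = k^2 the bounds n(k - 1) and k(n - k) coincide, leaving no slack. *)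
Lemma tight_card : #|N| = n.
Proof. by have := leq_trans tight_sum_ge tight_sum; nia. Qed.

Lemma tight_degree w : w \in N -> degree H w = k.
Proof.
move=> wN; apply/eqP; rewrite eqn_leq (upper_nbrs_degree wN) andbT leqNgt.
apply/negP => kw; have := tight_sum; rewrite leqNgt => /negP[].
apply: (@leq_trans (\sum_(x in N) (k.-1 + (x == w)))).
  rewrite big_split /= sum_nat_const tight_card (bigD1 w) //= eqxx; nia.
by apply: leq_sum => x /upper_nbrs_degree; case: eqP => [->|_]; lia.
Qed.

(** The n - k edges missing [v] contribute at most [k] each and at least k(n - k) in total, so none
    falls short. *)
Lemma tight_edge B : B \in edges H -> v \notin B -> k <= #|B :&: N|.
Proof.
move=> BH vB; rewrite leqNgt; apply/negP => Bk.
have := leq_trans tight_sum_ge (eq_leq (sum_degree_nbrs (@upper_nbrs_adj v))).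
rewrite leqNgt => /negP[].
apply: (@leq_ltn_trans (\sum_(A in [set A in edges H | v \notin A] :\ B) k
                        + k.-1)); last first.
  rewrite sum_nat_const tight_card.
  have := card_edges_missing v.
  rewrite (cardsD1 B) inE BH vB H_edges /= add1n; set D := #|_|.
  have : (n - k) * k = n * k.-1 by nia.
  by move=> <- <-; nia.
rewrite (bigD1 B) ?BH //= addnC; apply: leq_add; last by lia.
rewrite [leqRHS](eq_bigl (fun A => (A \in edges H) && (v \notin A) && (A != B)));
  last by move=> A; rewrite !inE andbC.
apply: leq_sum => A /andP[/andP[AH vA] _].
apply: leq_trans (card_adj_edge AH vA).
by apply/subset_leq_card/subsetP => w; rewrite !inE => /and3P[-> ->].
Qed.

(** An edge through [u] and [w] would miss [v], hence contain [k] vertices of [N] besides these two: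
    k + 2 vertices of degree at least [k]. But (k + 2)(k - 1) > n - 1. *)
Lemma tight_independent u w : k <= degree H u -> k <= degree H w ->
  u \notin N -> w \notin N -> ~~ adj u w.
Proof.
move=> ku kw uN wN; apply/negP => uw.
have vu : ~~ adj v u by apply: contra uN => vu; rewrite inE vu.
have vw : ~~ adj v w by apply: contra wN => vw; rewrite inE vw.
have /adjP[/eqP u_w [B [BH uB wB]]] := uw.
have vB : v \notin B.
  apply/negP => vB.
  have uv : u = v.
    apply: contraNeq vu => uv; apply/adjP.
    by split; [apply/eqP; rewrite eq_sym | exists B].
  by move: vw; rewrite -uv uw.
have := sum_degree_edge BH; rewrite H_edges leqNgt => /negP[].
pose S := u |: (w |: B :&: N).
have SB : S \subset B by rewrite !subUset !sub1set uB wB subsetIl.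
have cS : k.+2 <= #|S|.
  rewrite !cardsU1 !in_setU1 !in_setI (negPf u_w) (negPf uN) (negPf wN) !andbF.
  by have := tight_edge BH vB; lia.
have : #|S| * k.-1 <= \sum_(x in B) (degree H x).-1.
  rewrite -sum_nat_const [leqRHS](big_setID S) /= (setIidPr SB).
  apply: leq_trans (leq_addr _ _); apply: leq_sum => x.
  by case/setU1P=> [->|/setU1P[->|/setIP[_ /upper_nbrs_degree]]]; lia.
nia.
Qed.

Lemma tight_nonadjacent :
  exists w1 w2, [/\ w1 \in N, w2 \in N, w1 != w2 & ~~ adj w1 w2].
Proof.
(* Pigeonhole: the [k] edges at [v] cover the k^2 vertices of [N]. *)
have [A /andP[AH vA] Ak] : exists2 A, (A \in edges H) && (v \in A) & k <= #|A :&: N|.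
  apply/exists_inP; apply/contraT; rewrite negb_exists_in => /forall_inP small.
  have := leq_trans N_large (card_nbrs_le (@upper_nbrs_adj v)).
  rewrite leqNgt => /negP[]; apply: (@leq_ltn_trans (k * k.-1)); last by nia.
  rewrite -sum_edges_at_const; apply: leq_sum => A /small; lia.
have vN : v \notin N by rewrite inE adj_irr.
(* [A] has only n - 1 vertices besides [v], too few to contain [N]. *)
have [w1 w1N w1A] : exists2 w, w \in N & w \notin A.
  apply/subsetPn; apply/negP => NA.
  have : v |: N \subset A by rewrite subUset sub1set vA.
  move/subset_leq_card; rewrite cardsU1 vN (H_uniform AH); lia.
(* At most [k] vertices of [A] are adjacent to [w1], while [v] and [A :&: N] supply at least k +
   1. *)
have [w2] : exists2 w, w \in v |: (A :&: N) & w \notin [set w in A | adj w1 w].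
  apply/subsetPn; apply/negP => /subset_leq_card.
  rewrite cardsU1 inE (negPf vN) andbF /=.
  have := card_adj_edge AH w1A; rewrite (tight_degree w1N); lia.
rewrite !inE => /predU1P[->|/andP[w2A w2N]].
  by rewrite vA adj_sym (upper_nbrs_adj w1N).
rewrite w2A => w12; exists w1, w2; split=> //; first by rewrite inE.
by apply: contraNneq w1A => ->.
Qed.

(** The [n] vertices of [N] serve as colours. Giving [w1] the colour of its non-neighbour [w2] frees
    the colour [w1] for the independent set of vertices of degree at least [k] outside [N]. *)
Lemma tight_coloring : exists f : T -> 'I_n,
  proper_on adj [set w | k <= degree H w] f.
Proof.
have [w1 [w2 [w1N w2N w12 nadj12]]] := tight_nonadjacent.
pose r x := if x \in N then (if x == w1 then w2 else x) else w1.
have rN x : r x \in N by rewrite /r; case: ifP => // xN; case: ifP.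
exists (fun x => cast_ord tight_card (enum_rank_in w1N (r x))) => x y.
rewrite !inE => kx ky xy; rewrite (inj_eq (@cast_ord_inj _ _ _)).
apply/negP => /eqP/enum_rank_in_inj => /(_ (rN x) (rN y)); rewrite /r.
have [xN|xN] := boolP (x \in N); have [yN|yN] := boolP (y \in N).
- have [xw|_] := eqVneq x w1; have [yw|_] := eqVneq y w1 => E.
  + by move: xy; rewrite xw yw adj_irr.
  + by move: xy; rewrite xw -E (negPf nadj12).
  + by move: xy; rewrite yw E adj_sym (negPf nadj12).
  + by move: xy; rewrite E adj_irr.
- by have [_ /eqP|/eqP] := eqVneq x w1; [rewrite eq_sym (negPf w12) |].
- have [_ /eqP|yw /eqP] := eqVneq y w1; first by rewrite (negPf w12).
  by rewrite eq_sym (negPf yw).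
- by move: xy; rewrite (negPf (tight_independent kx ky xN yN)).
Qed.

End Tight.

(** * Existence of an n-colouring and the chromatic number *)

Lemma exists_coloring : weakly_dense H ->
  exists f : T -> 'I_n, proper_on adj setT f.
Proof.
move=> H_dense.
have [/existsP[v /and3P[k_gt1 /eqP k_sq N_large]]|no_tight] :=
  boolP [exists v, [&& 1 < degree H v, degree H v ^ 2 == n
                     & n <= #|upper_nbrs v|]].
  have [f f_proper] := tight_coloring k_gt1 k_sq N_large.
  apply: (greedy_coloring (d := degree H) adj_sym adj_irr f_proper).
    by move=> u w; rewrite !inE -ltnNge => ku /ltnW/leq_trans; apply.
  (* The remaining degrees have squares below [n], so the exceptional case cannot recur. *)
  move=> w; rewrite inE -ltnNge => wk; apply: few_upper_nbrs => // _.
  by rewrite -k_sq neq_ltn ltn_sqr wk.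
apply: (@greedy_coloring _ _ (degree H) n set0 (fun=> Ordinal n_gt0)) => //.
- exact: adj_sym.
- exact: adj_irr.
- by move=> u w; rewrite inE.
- by move=> u w; rewrite inE.
move=> v _; have [d2|ok] := boolP ((1 < degree H v) && (degree H v ^ 2 == n)).
  case/andP: d2 => k1 k2; rewrite ltnNge; apply: contra no_tight => nN.
  by apply/existsP; exists v; rewrite k1 k2.
apply: few_upper_nbrs => // k1; by move: ok; rewrite k1.
Qed.

End Uniform.

End Adjacency.

Theorem theorem3p7 (n : nat) (n_gt0 : 0 < n) (T : finType) (H : hypergraph T)
  (H_linear : linear_hypergraph H) (H_uniform : uniform_hypergraph H n)
  (H_edges : #|edges H| = n) (H_dense : weakly_dense H) :
  chromatic_number H = n.
Proof.
rewrite /chromatic_number; case: ex_minnP => m /existsP[f f_col] m_min.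
apply/eqP; rewrite eqn_leq; apply/andP; split.
  apply: m_min; apply/existsP.
  have [g g_proper] := exists_coloring H_linear n_gt0 H_uniform H_edges H_dense.
  exists [ffun v => g (val v)]; apply/forallP => u; apply/forallP => w.
  by apply/implyP => uw; rewrite !ffunE; apply: g_proper.
(* Lower bound: the [n] vertices of any one edge receive distinct colours. *)
have /card_gt0P[A AH] : 0 < #|edges H| by rewrite H_edges.
have AV x : x \in A -> x \in vertices H by move=> xA; apply/bigcupP; exists A.
pose A' := [set x : {v : T | v \in vertices H} | val x \in A].
have <- : #|A'| = n.
  rewrite -(H_uniform A AH) -(card_imset _ val_inj); apply: eq_card => x.
  apply/imsetP/idP => [[y + ->]|xA]; first by rewrite inE.
  by exists (Sub x (AV x xA)); rewrite ?inE SubK.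
rewrite -[m in _ <= m]card_ord -(@card_in_imset _ _ f A') ?max_card //.
move=> x y; rewrite !inE => xA yA fxy; apply: contraTeq f_col => xy.
apply/forallPn; exists x; apply/forallPn; exists y.
rewrite negb_imply xy fxy eqxx andbT; apply/exists_inP.
by exists A => //; rewrite xA.
Qed.
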